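(* (Converse duality) Let $Z,Y$ be Asplund spaces, $f:Z\to Y$ locally Lipschitz, $K\subset Y$ a pointed closed convex cone, $\mathcal{U}$ a sequentially compact topological space, and $g=(g_1,\dots,g_n)$ with $g_i:Z\times\mathcal{U}\to\mathbb{R}$. Let $(\bar z,\bar y^*,\bar\mu)\in F_{MW}$ be such that $\bar z\in F$. (i) If $(f,g)$ is type I pseudo convex at $\bar z$, then $\bar z\in\mathcal{S}^w(RP)$ (i.e. $\bar z$ is a weakly robust efficient solution). (ii) If $(f,g)$ is type II pseudo convex at $\bar z$, then $\bar z\in\mathcal{S}(RP)$ (i.e. $\bar z$ is a robust efficient solution).
   Context: Notation. $Z^*,Y^*$ are the topological duals; $\mathrm{cl}^*$ is weak$^*$ closure, $\mathrm{co}$ convex hull, $\mathrm{int}$ topological interior. $K$ pointed means $K\cap(-K)=\{0\}$. The dual cone is $K^+=\{y^*\in Y^*\mid \langle y^*,y\rangle\ge 0\ \forall y\in K\}$. $\langle y^*,f\rangle(z):=\langle y^*,f(z)\rangle$. $\mathbb{R}^n_+$ is the nonnegative orthant. Primal problem. $F=\{z\in Z\mid g_i(z,u)\le 0\ \forall u\in\mathcal{U},\ i=1,\dots,n\}$. $\bar z\in\mathcal{S}(RP)$ means $\bar z\in F$ and $f(z)-f(\bar z)\notin-K\setminus\{0\}$ for all $z\in F$. $\bar z\in\mathcal{S}^w(RP)$ means $\bar z\in F$ and $f(z)-f(\bar z)\notin-\mathrm{int}\,K$ for all $z\in F$. $\mathcal{U}_i(y):=\{u\in\mathcal{U}\mid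 g_i(y,u)=\max_{u'\in\mathcal{U}}g_i(y,u')\}$. Mond–Weir dual feasible set: $F_{MW}$ consists of all $(y,y^*,\mu)\in Z\times(K^+\setminus\{0\})\times\mathbb{R}^n_+$ for which there exist $u_i^*\in\mathrm{cl}^*\mathrm{co}\big(\bigcup\{\partial_z g_i(y,u)\mid u\in\mathcal{U}_i(y)\}\big)$, $i=1,\dots,n$, with $0\in\partial\langle y^*,f\rangle(y)+\sum_{i=1}^n\mu_i u_i^*$, and such that $\mu_i g_i(y,u)\ge 0$ for all $u\in\mathcal{U}_i(y)$, $i=1,\dots,n$. Generalized convexity. - $f$ is pseudo convex at $\bar z$ if for all $z\in Z$, $y^*\in K^+$: $\langle y^*,f\rangle(z)<\langle y^*,f\rangle(\bar z)$ implies $\langle v^*,z-\bar z\rangle<0$ for all $v^*\in\partial\langle y^*,f\rangle(\bar z)$. - $f$ is strictly pseudo convex at $\bar z$ if for all $z\in Z\setminus\{\bar z\}$, $y^*\in K^+\setminus\{0\}$: $\langle y^*,f\rangle(z)\le\langle y^*,f\rangle(\bar z)$ implies $\langle v^*,z-\bar z\rangle<0$ for all $v^*\in\partial\langle y^*,f\rangle(\bar z)$. - $g$ is generalized quasi convex at $\bar z$ if for all $z\in Z$, $u\in\mathcal{U}$ and $i=1,\dots,n$: $g_i(z,u)\le g_i(\bar z,u)$ implies $\langle u_i^*,z-\bar z\rangle\le 0$ for all $u_i^*\in\partial_z g_i(\bar z,u)$. - $(f,g)$ is type I (resp. type II) pseudo convex at $\bar z$ if $f$ is pseudo convex (resp.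 strictly pseudo convex) and $g$ is generalized quasi convex at $\bar z$. Subdifferential. For $\Gamma$ locally closed around $\bar x\in\Gamma$: the Fréchet normal cone is $\widehat N(\bar x;\Gamma)=\{x^*\mid\limsup_{x\to\bar x,\,x\in\Gamma}\langle x^*,x-\bar x\rangle/\|x-\bar x\|\le 0\}$, and the Mordukhovich normal cone $N(\bar x;\Gamma)$ is the set of $x^*$ for which there are sequences $x_k\to\bar x$, $x_k\in\Gamma$, and $x_k^*\in\widehat N(x_k;\Gamma)$ with $x_k^*\to x^*$ weak$^*$. The limiting (Mordukhovich) subdifferential of $\varphi:Z\to\overline{\mathbb{R}}$ at $\bar z$ with $\varphi(\bar z)$ finite is $\partial\varphi(\bar z)=\{z^*\in Z^*\mid(z^*,-1)\in N((\bar z,\varphi(\bar z));\mathrm{epi}\,\varphi)\}$. $\partial_z g_i(z,u)$ is the limiting subdifferential of $g_i(\cdot,u)$ at $z$. *)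

(* Defs.v *)
From HB Require Import structures.
From mathcomp Require Import all_boot all_order all_algebra.
From mathcomp Require Import all_classical all_reals all_analysis.

Set Implicit Arguments.
Unset Strict Implicit.
Unset Printing Implicit Defensive.
Import Order.TTheory GRing.Theory Num.Theory.
Import numFieldNormedType.Exports.
Local Open Scope classical_set_scope.
Local Open Scope ring_scope.

Definition dual (R : realType) (X : normedModType R) : set (X -> R^o) :=
  [set l | linear l /\ continuous l].
Arguments dual {R} X _.

Section Duality.
Context {R : realType}.

(* The weak* topology on the dual is the trace of the topology of pointwise
   convergence on all functions [X -> R]. *)
Definition weak_star_closure (X : normedModType R) (A : set (X -> R^o)) :
    set (X -> R^o) :=
  dual X `&` closure (A : set {ptws X -> R^o}).

Definition convex_hull (M : lmodType R) (A : set M) : set M :=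
  smallest (@convex_set R M) A.

Definition asplund (X : completeNormedModType R) : Prop :=
  forall (U : set X) (phi : X -> R^o),
    open U -> convex_set U -> {within U, continuous phi} ->
    convex_function U phi ->
    U `<=` closure (U `&` [set x | differentiable phi x]).

Definition locally_lipschitz (X Y : normedModType R) (f : X -> Y) : Prop :=
  forall x : X, exists2 V, nbhs x V & [lipschitz f z | z in V].

Definition sequentially_compact (T : topologicalType) : Prop :=
  forall s : nat -> T, exists2 k : nat -> nat,
    {homo k : i j / (i < j)%N} & exists t : T, (s \o k) @ \oo --> t.

Definition cone (Y : lmodType R) (K : set Y) : Prop :=
  forall (t : R) y, 0 <= t -> K y -> K (t *: y).

Definition pointed (Y : lmodType R) (K : set Y) : Prop :=
  K `&` (-%R @` K) = [set 0].

Definition dual_cone (Y : normedModType R) (K : set Y) : set (Y -> R^o) :=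
  dual Y `&` [set l | forall y, K y -> 0 <= l y].

End Duality.

Section Subdifferential.
Context {R : realType}.

Definition frechet_normal_cone (X : normedModType R) (G : set X) (x : X) :
    set (X -> R^o) :=
  dual X `&` [set l |
    (limf_esup (fun y => (l (y - x) / `|y - x|)%:E) (within G x^') <= 0)%E].

Definition limiting_normal_cone (X : normedModType R) (G : set X) (x : X) :
    set (X -> R^o) :=
  dual X `&` [set l | exists (xs : nat -> X) (ls : nat -> {ptws X -> R^o}),
    [/\ xs @ \oo --> x,
        forall k, G (xs k),
        forall k, frechet_normal_cone G (xs k) (ls k) &
        ls @ \oo --> (l : {ptws X -> R^o})]].

Definition epigraph (Z : normedModType R) (phi : Z -> \bar R) : set (Z * R^o) :=
  [set p | (phi p.1 <= p.2%:E)%E].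

(* The element [(l, a)] of the dual of [Z * R], identified with [Z^* * R]. *)
Definition pair_functional (Z : normedModType R) (l : Z -> R^o) (a : R) :
    Z * R^o -> R^o :=
  fun p => l p.1 + a * p.2.

Definition limiting_subdifferential (Z : normedModType R) (phi : Z -> \bar R)
    (z : Z) : set (Z -> R^o) :=
  dual Z `&` [set l | phi z \is a fin_num /\
    limiting_normal_cone (epigraph phi) (z, fine (phi z))
      (pair_functional l (-1))].

Definition subdiff (Z : normedModType R) (phi : Z -> R) (z : Z) :
    set (Z -> R^o) :=
  limiting_subdifferential (EFin \o phi) z.

End Subdifferential.

Section RobustProblem.
Context {R : realType} {Z Y : normedModType R} {U : topologicalType} {n : nat}.
Variables (f : Z -> Y) (K : set Y) (g : 'I_n -> Z -> U -> R).

Definition robust_feasible : set Z := [set z | forall u i, g i z u <= 0].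

Definition robust_efficient : set Z :=
  [set z0 | robust_feasible z0 /\
    forall z, robust_feasible z -> ~ (-%R @` (K `\ 0)) (f z - f z0)].

Definition weakly_robust_efficient : set Z :=
  [set z0 | robust_feasible z0 /\
    forall z, robust_feasible z -> ~ (-%R @` K°) (f z - f z0)].

(* Empty when the maximum over [U] is not attained. *)
Definition active (i : 'I_n) (y : Z) : set U :=
  [set u | forall u', g i y u' <= g i y u].

Definition mond_weir_feasible : set (Z * (Y -> R^o) * 'rV[R]_n) :=
  [set w : Z * (Y -> R^o) * 'rV[R]_n | let: (y, ys, mu) := w in
    [/\ (dual_cone K `\ 0) ys,
        forall i, 0 <= mu ord0 i,
        exists us : 'I_n -> Z -> R^o,
          (forall i, weak_star_closure (convex_hull
             (\bigcup_(u in active i y) subdiff (g i ^~ u) y)) (us i)) /\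
          [set v + \sum_(i < n) mu ord0 i *: us i | v in subdiff (ys \o f) y] 0
      & forall i u, active i y u -> 0 <= mu ord0 i * g i y u]].

Definition pseudo_convex (z0 : Z) : Prop :=
  forall z ys, dual_cone K ys -> ys (f z) < ys (f z0) ->
    forall v, subdiff (ys \o f) z0 v -> v (z - z0) < 0.

Definition strictly_pseudo_convex (z0 : Z) : Prop :=
  forall z ys, z <> z0 -> (dual_cone K `\ 0) ys -> ys (f z) <= ys (f z0) ->
    forall v, subdiff (ys \o f) z0 v -> v (z - z0) < 0.

Definition generalized_quasi_convex (z0 : Z) : Prop :=
  forall z u i, g i z u <= g i z0 u ->
    forall v, subdiff (g i ^~ u) z0 v -> v (z - z0) <= 0.

Definition typeI_pseudo_convex (z0 : Z) : Prop :=
  pseudo_convex z0 /\ generalized_quasi_convex z0.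

Definition typeII_pseudo_convex (z0 : Z) : Prop :=
  strictly_pseudo_convex z0 /\ generalized_quasi_convex z0.

End RobustProblem.

(* Main.v *)
Require Import Defs.
From mathcomp Require Import all_boot all_order all_algebra.
From mathcomp Require Import all_classical all_reals all_analysis.
Import numFieldNormedType.Exports.
Local Open Scope classical_set_scope.
Local Open Scope ring_scope.
Import Order.TTheory GRing.Theory Num.Theory.

(** Fix a feasible [z] and test the stationarity equation
    [0 = v + \sum_i mu_i u_i] of the dual problem in the direction [z - zbar].

    The constraint part of this equation is nonpositive there
    ([multiplier_sum_le0]).  If [mu_i > 0] and [u] is active at [zbar], dual
    feasibility gives [g_i(zbar, u) >= 0 >= g_i(z, u)], so quasi convexity puts
    every subgradient of [g_i(-, u)] at [zbar] in the half space of functionals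
    nonpositive at [z - zbar].  Half spaces of this kind are convex and weak*
    closed, hence they also contain [u_i] ([weak_star_hull_le]).  Consequently
    [v (z - zbar) >= 0].

    If [zbar] were not (weakly) efficient, some feasible [z] would have
    [f z - f zbar = - k] with [k] in [K] (in its interior).  Then
    [ybar (f z) = ybar (f zbar) - ybar k] lies below [ybar (f zbar)], strictly
    so when [k] is interior, since a nonzero element of the dual cone is
    positive on the interior of the cone ([dual_cone_interior_gt0]).
    Pseudo convexity of [f] now yields [v (z - zbar) < 0], a contradiction. *)

(** The half space [{l | l x <= c}] is convex, and closed for pointwise
    convergence because evaluation at [x] is continuous. *)
Lemma weak_star_hull_le {R : realType} {X : normedModType R}
    {A : set (X -> R^o)} {x : X} {c : R} :
  (forall l, A l -> l x <= c) ->
  forall l, weak_star_closure (convex_hull A) l -> l x <= c.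
Proof.
move=> Ax l [_]; pose H : set {ptws X -> R^o} := [set m | m x <= c].
have H_closed : closed H.
  apply: (@preimage_closed _ _ (fun m : {ptws X -> R^o} => m x)
    [set r : R^o | r <= c]); last exact: closed_le.
  by move=> m _; exact: proj_continuous.
suff hullH : (convex_hull A : set {ptws X -> R^o}) `<=` H.
  by move=> /(closureS hullH); rewrite -(iffLR (closure_id H) H_closed).
apply: smallest_sub => // m1 m2 t /[!inE]; rewrite /H/= => m1x m2x.
change (t%:num * m1 x + (1 - t%:num) * m2 x <= c).
have -> : c = t%:num * c + (1 - t%:num) * c by rewrite -mulrDl subrKC mul1r.
by rewrite lerD// ler_wpM2l// subr_ge0.
Qed.

(** Choose [y] with [ys y != 0].  Moving from [k] a short way along
    [- ys y *: y] strictly decreases [ys] and stays in [K], where [ys] is still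
    nonnegative. *)
Lemma dual_cone_interior_gt0 {R : realType} {Y : normedModType R} {K : set Y}
    {ys : Y -> R^o} {k : Y} :
  (dual_cone K `\ 0) ys -> K° k -> 0 < ys k.
Proof.
move=> [[[ys_lin _] ys_ge0] ys_neq0] Kk.
have [y ysy] : exists y, ys y != 0.
  apply: contra_notP ys_neq0 => /forallNP ys_eq0; apply/funext => y.
  by apply/eqP; apply: contra_notT (ys_eq0 y).
have path_cvg : (fun t : R => - (t * ys y) *: y + k) @ 0^'+ --> k.
  rewrite -[X in _ --> X]add0r -[X in X + k](scale0r y) -[X in X *: y]oppr0.
  rewrite -[X in - X](mul0r (ys y)).
  apply: cvgD; last exact: cvg_cst.
  apply: cvgZl; apply: cvgN; apply: cvgMl.
  by apply: cvg_at_right_filter; exact: cvg_id.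
have [t [t_gt0 Kt]] : exists t : R, 0 < t /\ K (- (t * ys y) *: y + k).
  near (0 : R)^'+ => t; exists t; split => //.
  by near: t; apply: path_cvg; exact: Kk.
have step_gt0 : 0 < t * ys y * ys y.
  by rewrite -mulrA mulr_gt0// -expr2 exprn_even_gt0.
apply: lt_le_trans step_gt0 _.
have := ys_ge0 _ Kt; rewrite ys_lin => ys_step.
by rewrite -subr_ge0 addrC -mulNr.
Unshelve. all: by end_near. Qed.

(** Sign condition and feasibility together play the role of complementary
    slackness: an index with [mu_i > 0] has [g_i(y, u) >= 0 >= g_i(z, u)] at
    every active [u], so quasi convexity applies to each generator of the
    hull containing [us i]. *)
Lemma multiplier_sum_le0 {R : realType} {Z : normedModType R}
    {U : topologicalType} {n : nat} {g : 'I_n -> Z -> U -> R}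
    {y z : Z} {mu : 'rV[R]_n} {us : 'I_n -> Z -> R^o} :
  (forall i, 0 <= mu ord0 i) ->
  (forall i u, active g i y u -> 0 <= mu ord0 i * g i y u) ->
  (forall i, weak_star_closure (convex_hull
     (\bigcup_(u in active g i y) subdiff (g i ^~ u) y)) (us i)) ->
  generalized_quasi_convex g y -> robust_feasible g z ->
  \sum_(i < n) mu ord0 i * us i (z - y) <= 0.
Proof.
move=> mu_ge0 mug_ge0 us_hull g_qc z_feas; apply: sumr_le0 => i _.
have [->|mui_neq0] := eqVneq (mu ord0 i) 0; first by rewrite mul0r.
have mui_gt0 : 0 < mu ord0 i by rewrite lt_neqAle eq_sym mui_neq0 mu_ge0.
rewrite pmulr_rle0//; apply: weak_star_hull_le (us_hull i) => l [u u_act].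
apply: g_qc; apply: le_trans (z_feas u i) _.
by rewrite -(pmulr_rge0 _ mui_gt0) mug_ge0.
Qed.

Theorem theorem4p4 (R : realType) (Z Y : completeNormedModType R)
    (U : topologicalType) (n : nat)
    (f : Z -> Y) (K : set Y) (g : 'I_n -> Z -> U -> R)
    (zbar : Z) (ybar : Y -> R^o) (mubar : 'rV[R]_n)
    (asplundZ : asplund Z) (asplundY : asplund Y)
    (f_lipschitz : locally_lipschitz f)
    (K_cone : cone K) (K_convex : convex_set K) (K_closed : closed K)
    (K_pointed : pointed K)
    (U_seqcompact : sequentially_compact U)
    (dual_feasible : mond_weir_feasible f K g (zbar, ybar, mubar))
    (primal_feasible : robust_feasible g zbar) :
  (typeI_pseudo_convex f K g zbar -> weakly_robust_efficient f K g zbar) /\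
  (typeII_pseudo_convex f K g zbar -> robust_efficient f K g zbar).
Proof.
case: dual_feasible => ybarK mu_ge0 [us [us_hull [v v_sub v_us]]] mug_ge0.
have [[[ybar_lin _] ybar_ge0] _] := ybarK.
have v_ge0 : generalized_quasi_convex g zbar ->
    forall z, robust_feasible g z -> 0 <= v (z - zbar).
  move=> g_qc z z_feas.
  have : (v + \sum_(i < n) mubar ord0 i *: us i) (z - zbar) = 0 by rewrite v_us.
  rewrite addrfctE fct_sumE => /eqP; rewrite addr_eq0 => /eqP ->.
  rewrite oppr_ge0.
  exact: (multiplier_sum_le0 mu_ge0 mug_ge0 us_hull g_qc z_feas).
have ybar_drop z k : - k = f z - f zbar -> ybar (f z) = ybar (f zbar) - ybar k.
  move=> /eqP; rewrite -subr_eq opprK -scaleN1r => /eqP <-.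
  by rewrite ybar_lin scaleN1r addrC.
split=> [[f_pc g_qc]|[f_spc g_qc]]; split=> // z z_feas [k].
  move=> Kk kE.
  have := v_ge0 g_qc z z_feas; rewrite leNgt => /negP; apply.
  apply: f_pc v_sub; first exact: ybarK.1.
  by rewrite (ybar_drop _ _ kE) gtrBl (dual_cone_interior_gt0 ybarK Kk).
move=> [Kk k_neq0] kE.
have := v_ge0 g_qc z z_feas; rewrite leNgt => /negP; apply.
apply: (f_spc z _ _ ybarK) v_sub.
  (* [z = zbar] would force [k = 0]. *)
  move=> zE; apply: k_neq0; rewrite zE subrr in kE.
  by apply/eqP; rewrite -oppr_eq0 kE.
by rewrite (ybar_drop _ _ kE) gerBl ybar_ge0.
Qed.
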